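(* Let $\mathcal{C}=(X_1,\dots,X_k)$ be a collection of itemsets over items $A=\{a_1,\dots,a_N\}$, and let $\mathcal{T}_{\mathcal{C}}$ be the corresponding partition of $\mathcal{T}=\{0,1\}^N$. Run the following procedure (QieBlockSizes). First, for each block $T\in\mathcal{T}_{\mathcal{C}}$, set $e(T)\leftarrow 2^{N-|I_T|}$ where $I_T=\bigcup\{X: X\in\mathrm{sets}(T;\mathcal{C})\}$. Then for $i=1,\dots,k$ and for each block $T\in\mathcal{T}_{\mathcal{C}}$: let $\mathcal{G}=\mathrm{sets}(T;\mathcal{C})$; if $X_i\notin\mathcal{G}$, let $\mathcal{G}'=\mathrm{closure}(\mathcal{G}\cup\{X_i\},i-1)$ and $T'=\mathrm{block}(\mathcal{G}')$, and if $T'\neq\emptyset$ set $e(T)\leftarrow e(T)-e(T')$. Then at termination, $e(T)$ equals the number of transactions in $T$, for every $T\in\mathcal{T}_{\mathcal{C}}$.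
   Context: For an itemset $X\subseteq A$, $S_X(t)=1$ iff $t_i=1$ for all $a_i\in X$. The collection $\mathcal{C}$ partitions $\mathcal{T}$ into blocks: $t_1,t_2$ lie in the same block iff $S_X(t_1)=S_X(t_2)$ for all $X\in\mathcal{C}$; $\mathcal{T}_{\mathcal{C}}$ denotes this partition and $S_X(T)$ the common value on block $T$. $\mathrm{sets}(T;\mathcal{C})=\{X\in\mathcal{C}:S_X(T)=1\}$. For $\mathcal{G}\subseteq\mathcal{C}$: $\mathrm{closure}(\mathcal{G})=\{X\in\mathcal{C}: X\subseteq\bigcup_{Y\in\mathcal{G}}Y\}$; the $j$-prefix is $\mathcal{C}_j=\{X_1,\dots,X_j\}$; the $j$-closure is $\mathrm{closure}(\mathcal{G},j)=\mathcal{G}\cup(\mathrm{closure}(\mathcal{G})\setminus\mathcal{C}_j)$. $\mathrm{block}(\mathcal{G})$ is the block $T\in\mathcal{T}_{\mathcal{C}}$ with $\mathrm{sets}(T;\mathcal{C})=\mathcal{G}$ if $\mathrm{closure}(\mathcal{G})=\mathcal{G}$ (such a block exists and is unique), and is $\emptyset$ otherwise. *)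

(* Defs.v *)
From HB Require Import structures.
From mathcomp Require Import all_boot all_order all_algebra.

Set Implicit Arguments.
Unset Strict Implicit.
Unset Printing Implicit Defensive.

Import GRing.Theory Num.Theory.

Local Open Scope ring_scope.

Section Itemsets.

Variable N : nat.

Definition itemset : finType := {set 'I_N}.

Definition transaction : finType := {ffun 'I_N -> bool}.

Definition covers (X : itemset) (t : transaction) : bool :=
  [forall i in X, t i].

Definition same_block (C : {set itemset}) : rel transaction :=
  fun t1 t2 => [forall X in C, covers X t1 == covers X t2].

Definition blocks (C : {set itemset}) : {set {set transaction}} :=
  equivalence_partition (same_block C) [set: transaction].

(* When X belongs to C and T is a block of C, [covers X] is constant on T and
   this is its common value: see [covers_blockE]. *)
Definition covers_block (X : itemset) (T : {set transaction}) : bool :=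
  [forall t in T, covers X t].

Definition sets (T : {set transaction}) (C : {set itemset}) : {set itemset} :=
  [set X in C | covers_block X T].

Definition iclosure (C G : {set itemset}) : {set itemset} :=
  [set X in C | X \subset cover G].

(* For closed G exactly one block satisfies the test ([block_spec] and
   [sets_inj]), so that neither the choice made by [pick] nor its default value
   matters. *)
Definition block (C G : {set itemset}) : {set transaction} :=
  if iclosure C G == G
  then odflt set0 [pick T in blocks C | sets T C == G]
  else set0.

Lemma same_block_equiv (C : {set itemset}) :
  {in [set: transaction] & &, equivalence_rel (same_block C)}.
Proof.
move=> x y z _ _ _; split; first by apply/forall_inP.
move=> /forall_inP xy; apply/forall_inP/forall_inP => h X XC.
  by rewrite -(eqP (xy X XC)) h.
by rewrite (eqP (xy X XC)) h.
Qed.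

Lemma blocks_partition (C : {set itemset}) :
  partition (blocks C) [set: transaction].
Proof. exact: equivalence_partitionP (@same_block_equiv C). Qed.

Lemma blocksP (C : {set itemset}) (T : {set transaction}) :
  reflect (exists t, T = [set u | same_block C t u]) (T \in blocks C).
Proof.
apply: (iffP imsetP) => [[t _ ->] | [t ->]]; exists t => //;
  by apply/setP=> u; rewrite !inE.
Qed.

Lemma covers_blockE (C : {set itemset}) (T : {set transaction})
    (X : itemset) (t : transaction) :
  T \in blocks C -> X \in C -> t \in T -> covers_block X T = covers X t.
Proof.
move=> /blocksP[u ->] XC; rewrite inE => /forall_inP ut.
rewrite -(eqP (ut X XC)); apply/forall_inP/idP => [|uX v].
  by apply; rewrite inE; apply/forall_inP.
by rewrite inE => /forall_inP/(_ X XC)/eqP <-.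
Qed.

Lemma sets_inj (C : {set itemset}) : {in blocks C &, injective (sets^~ C)}.
Proof.
move=> T U TC UC /setP eTU.
have [t Tt] := blocksP C T TC; have [u Uu] := blocksP C U UC.
have tT : t \in T by rewrite Tt inE; apply/forall_inP.
have uU : u \in U by rewrite Uu inE; apply/forall_inP.
have etu X : X \in C -> covers X t = covers X u.
  move=> XC; move: (eTU X).
  by rewrite !inE XC /= (covers_blockE TC XC tT) (covers_blockE UC XC uU).
rewrite Tt Uu; apply/setP=> v; rewrite !inE.
by apply/forall_inP/forall_inP => h X XC; move: (h X XC); rewrite etu.
Qed.

Lemma block_spec (C G : {set itemset}) :
  iclosure C G = G -> block C G \in blocks C /\ sets (block C G) C = G.
Proof.
move=> clG; rewrite /block clG eqxx; case: pickP => [T /andP[TC /eqP] // | noT].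
pose t : transaction := [ffun i => i \in cover G].
pose T := [set u | same_block C t u].
have TC : T \in blocks C by apply/blocksP; exists t.
have tT : t \in T by rewrite inE; apply/forall_inP.
have /negP[] := negbT (noT T); rewrite TC /=; apply/eqP.
rewrite -[RHS]clG; apply/setP=> X; rewrite !inE; case XC: (X \in C) => //=.
rewrite (covers_blockE TC XC tT); apply/forall_inP/subsetP => h i /h;
  by rewrite ffunE.
Qed.

Definition state : Type := {set transaction} -> int.

Section Procedure.

(* The collection (X_1, ..., X_k); with indices in 'I_k, X_i is
   [tnth C (i - 1)]. *)
Variables (k : nat) (C : k.-tuple itemset).

Definition collection : {set itemset} := [set X in C].

Definition jprefix (j : nat) : {set itemset} := [set X in take j C].

Definition jclosure (G : {set itemset}) (j : nat) : {set itemset} :=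
  G :|: (iclosure collection G :\: jprefix j).

Definition init_sizes : state :=
  fun T => (2 ^ (N - #|cover (sets T collection)|))%N%:Z.

(* As i : 'I_k counts from 0, it is also the length of the prefix that
   precedes [tnth C i]. *)
Definition update (i : 'I_k) (e : state) (T : {set transaction}) : state :=
  let G := sets T collection in
  if tnth C i \in G then e else
  let T' := block collection (jclosure (G :|: [set tnth C i]) i) in
  if T' == set0 then e else
  fun U => if U == T then e T - e T' else e U.

(* [visit i] lists the blocks in the order in which round i visits them. *)
Definition QieBlockSizes (visit : 'I_k -> seq {set transaction}) : state :=
  foldl (fun e i => foldl (update i) e (visit i)) init_sizes (enum 'I_k).

End Procedure.

End Itemsets.

(* Main.v *)
(** After round [j], [e T] counts the transactions that cover every itemset of
    [G = sets T] and, among [X_1, ..., X_j], cover only members of [G].  For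
    [j = 0] this is a power of two, and for [j = k] it is the size of [T].  When
    [X_i] is not in [G], round [i] has to discard the transactions that also
    cover [X_i]; these are exactly the ones counted by [G'] after round [i - 1],
    as [G'] and [G + X_i] have the same union and [G'] has the same members as
    [G] among [X_1, ..., X_(i-1)].  If [G'] is not closed there are none. *)

Require Import Defs.
From HB Require Import structures.
From mathcomp Require Import all_boot all_order all_algebra.

Set Implicit Arguments.
Unset Strict Implicit.
Unset Printing Implicit Defensive.

Import GRing.Theory Num.Theory.

Local Open Scope ring_scope.

Lemma covers_cover (N : nat) (G : {set itemset N}) (t : transaction N) :
  covers (cover G) t = [forall X in G, covers X t].
Proof.
apply/forall_inP/forall_inP => [h X XG | h i].
  by apply/forall_inP=> i iX; apply: h; apply/bigcupP; exists X.
by case/bigcupP=> X /h /forall_inP; apply.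
Qed.

Lemma card_covers (N : nat) (X : itemset N) :
  #|[set t | covers X t]| = (2 ^ (N - #|X|))%N.
Proof.
have -> : (N - #|X|)%N = #|~: X| by rewrite [RHS]cardsCs setCK card_ord.
(* A transaction covers [X] iff it differs from [true] only on [~: X], where its values are free: a
   partial function with default [true]. *)
rewrite -[2%N]card_bool -(card_pffun_on true) cardsE.
apply: eq_card => t; rewrite !unfold_in; apply/idP/idP => [/forall_inP tX | ].
  apply/pffun_onP; split=> //; apply/subsetP => i.
  by rewrite !inE; apply: contra => /tX ->.
case/pffun_onP => /subsetP sX _; apply/forall_inP => i iX.
by have := sX i; rewrite !inE iX; case: (t i) => // /(_ isT).
Qed.

(** [G] is arbitrary here because the [G'] of a round need not be closed, hence need not be the sets
    of any block. *)
Definition partial_block (N k : nat) (C : k.-tuple (itemset N)) (j : nat)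
    (G : {set itemset N}) : {set transaction N} :=
  [set t | covers (cover G) t &&
           [forall X in jprefix C j, covers X t ==> (X \in G)]].

(** Over the full prefix, the two conditions together fix which members of the collection are
    covered, and this determines the block. *)
Lemma partial_block_full (N k : nat) (C : k.-tuple (itemset N))
    (T : {set transaction N}) :
  T \in blocks (collection C) ->
  partial_block C k (sets T (collection C)) = T.
Proof.
move=> TC; have [t Tt] := blocksP _ _ TC.
have tT : t \in T by rewrite Tt inE; apply/forall_inP.
have jC : jprefix C k = collection C.
  by apply/setP => X; rewrite !inE take_oversize // size_tuple.
apply/setP => u; rewrite [in RHS]Tt !inE jC covers_cover.
apply/andP/forall_inP => [[/forall_inP uG /forall_inP uC] X XC | h].
  have := uC X XC; have := uG X; rewrite inE XC (covers_blockE TC XC tT) /=.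
  by case: (covers X t) => [->|] //; rewrite implybF => _ /negPf->.
split; apply/forall_inP => X; rewrite ?[_ \in sets _ _]inE.
  by case/andP=> XC; rewrite (covers_blockE TC XC tT) (eqP (h X XC)).
by move=> XC; rewrite XC (covers_blockE TC XC tT) (eqP (h X XC)) implybb.
Qed.

Section Round.

Variables (N k : nat) (C : k.-tuple (itemset N)).

Lemma jprefixS (i : 'I_k) : jprefix C i.+1 = tnth C i |: jprefix C i.
Proof.
apply/setP => X; rewrite !inE (take_nth (tnth C i)) ?size_tuple //.
by rewrite mem_rcons inE -tnth_nth.
Qed.

Lemma partial_blockS_mem (i : 'I_k) (G : {set itemset N}) :
  tnth C i \in G -> partial_block C i.+1 G = partial_block C i G.
Proof.
move=> XG; apply/setP => t; rewrite !inE jprefixS; congr andb.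
apply/forall_inP/forall_inP => h X XC; first by apply: h; rewrite inE XC orbT.
by case/setU1P: XC => [->|/h //]; rewrite XG implybT.
Qed.

Hypothesis uniqC : uniq C.

(** Distinctness of the itemsets enters here: a repeated itemset would already lie in the prefix. *)
Lemma tnth_jprefix (i : 'I_k) : tnth C i \notin jprefix C i.
Proof.
rewrite inE (tnth_nth (tnth C i)).
have szi : (i < size C)%N by rewrite size_tuple.
have := take_uniq i.+1 uniqC.
by rewrite (take_nth (tnth C i)) // rcons_uniq => /andP[].
Qed.

Lemma cover_jclosure (G : {set itemset N}) (j : nat) :
  cover (jclosure C G j) = cover G.
Proof.
apply/eqP; rewrite eqEsubset; apply/andP; split; last first.
  by apply/bigcupsP => X XG; apply: bigcup_sup; rewrite inE XG.
apply/bigcupsP => X; rewrite !inE => /orP[XG | /and3P[_ _ //]].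
exact: bigcup_sup.
Qed.

(** The closure adds only sets outside the prefix, and [tnth C i] is outside it too. *)
Lemma mem_jclosure_prefix (i : 'I_k) (G : {set itemset N}) X :
  X \in jprefix C i ->
  (X \in jclosure C (G :|: [set tnth C i]) i) = (X \in G).
Proof.
move=> XC; rewrite in_setU in_setD XC /= orbF.
rewrite inE in_set1; case: eqP => [eX | _]; last by rewrite orbF.
by rewrite eX (negPf (tnth_jprefix i)) in XC.
Qed.

Lemma partial_block_jclosure (i : 'I_k) (G : {set itemset N}) :
  partial_block C i (jclosure C (G :|: [set tnth C i]) i) =
  [set t in partial_block C i G | covers (tnth C i) t].
Proof.
apply/setP => t; rewrite !inE cover_jclosure !covers_cover.
rewrite andbAC; congr andb.
  apply/forall_inP/andP => [h | [/forall_inP hG hX] X].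
    split; last by apply: h; rewrite !inE eqxx orbT.
    by apply/forall_inP => X XG; apply: h; rewrite inE XG.
  by rewrite !inE => /orP[/hG // | /eqP ->].
apply: eq_forallb => X; case XC: (X \in jprefix C i) => //=.
by rewrite mem_jclosure_prefix.
Qed.

Lemma partial_blockS_notin (i : 'I_k) (G : {set itemset N}) :
  tnth C i \notin G ->
  partial_block C i.+1 G =
  partial_block C i G :\: [set t | covers (tnth C i) t].
Proof.
move=> XG; apply/setP => t; rewrite !inE jprefixS andbCA; congr andb.
apply/forall_inP/andP => [h | [tX /forall_inP h] X].
  split; last by apply/forall_inP => X XC; apply: h; rewrite inE XC orbT.
  by have := h _ (setU11 _ _); rewrite (negPf XG) implybF.
by case/setU1P => [->|/h //]; rewrite (negPf tX).
Qed.

(* A set [X] in the closure of [G'] but not in [G'] lies in the prefix and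
   outside [G], so no transaction can cover [G'] and avoid [X]. *)
Lemma partial_block_not_closed (i : 'I_k) (G : {set itemset N}) :
  G \subset collection C ->
  let G' := jclosure C (G :|: [set tnth C i]) i in
  iclosure (collection C) G' != G' -> partial_block C i G' = set0.
Proof.
move=> GC G' nclG'; apply: contraNeq nclG' => /set0Pn[t].
rewrite inE => /andP[/forall_inP tG' /forall_inP tC].
apply/eqP/setP => X; rewrite inE.
apply/andP/idP => [[XC XG'] | XG']; last first.
  split; last exact: bigcup_sup.
  case/setUP: XG' => [/setUP[XG | /set1P ->] | ].
  - exact: (subsetP GC).
  - by rewrite inE mem_tnth.
  - by rewrite !inE => /and3P[].
have [XCi | XCi] := boolP (X \in jprefix C i).
  apply: (implyP (tC X XCi)); apply/forall_inP => a aX; apply: tG'.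
  exact: (subsetP XG').
rewrite in_setU in_setD XCi [_ \in iclosure _ _]inE XC.
by rewrite -(cover_jclosure _ i) XG' orbT.
Qed.

(** Besides [T], only blocks whose sets contain [tnth C i] are constrained, so the lemma applies in
    the middle of a round, when other blocks may have been updated. *)
Lemma update_partial_block (i : 'I_k) (e : state N) (T : {set transaction N}) :
  e T = #|partial_block C i (sets T (collection C))|%:Z ->
  (forall U, U \in blocks (collection C) ->
    tnth C i \in sets U (collection C) ->
    e U = #|partial_block C i (sets U (collection C))|%:Z) ->
  update C i e T T = #|partial_block C i.+1 (sets T (collection C))|%:Z.
Proof.
move=> eT eX; rewrite /update; case: ifPn => XG.
  by rewrite partial_blockS_mem.
set G := sets T _ in XG eT *; set G' := jclosure _ _ _.
have cardS : #|partial_block C i.+1 G|%:Z =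
    #|partial_block C i G|%:Z - #|partial_block C i G'|%:Z.
  rewrite partial_blockS_notin // partial_block_jclosure.
  rewrite -(cardsID [set t | covers (tnth C i) t] (partial_block C i G)).
  by rewrite PoszD addrAC -setIdE subrr add0r.
have GC : G \subset collection C by apply/subsetP => X; rewrite inE => /andP[].
have [clG' | nclG'] := eqVneq (iclosure (collection C) G') G'; last first.
  rewrite /block (negPf nclG') eqxx eT cardS.
  by rewrite (partial_block_not_closed GC nclG') cards0 subr0.
have [T'C setsT'] := block_spec clG'.
(* Blocks are nonempty, so for closed [G'] the test against [set0] fails and the subtraction takes
   place. *)
have /and3P[_ _ n0] := blocks_partition (collection C).
have -> : (block (collection C) G' == set0) = false.
  by apply: contraNF n0 => /eqP <-.
rewrite eqxx eT eX // setsT' ?cardS //.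
by rewrite !inE eqxx orbT.
Qed.

Lemma update_neq (i : 'I_k) (e : state N) (T U : {set transaction N}) :
  U != T -> update C i e T U = e U.
Proof.
by move=> /negPf UT; rewrite /update; do 2!case: ifP => // _; rewrite UT.
Qed.

(* The correction subtracted from [T] is read at a block whose sets contain
   [tnth C i], and round [i] leaves such blocks alone: the order of the visits
   is irrelevant. *)
Lemma round_partial_block (i : 'I_k) (e : state N)
    (s : seq {set transaction N}) :
  uniq s -> {subset s <= blocks (collection C)} ->
  (forall U, U \in blocks (collection C) ->
    e U = #|partial_block C i (sets U (collection C))|%:Z) ->
  forall U, U \in blocks (collection C) ->
    foldl (update C i) e s U =
    #|partial_block C (if U \in s then i.+1 else i) (sets U (collection C))|%:Z.
Proof.
move=> + + eC; elim/last_ind: s => [|s T IHs] /=; first by move=> _ _ U /eC.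
rewrite rcons_uniq foldl_rcons => /andP[Ts us] sC U UC.
have {}IHs := IHs us (fun V Vs => sC V (mem_subseq (subseq_rcons s T) Vs)).
rewrite mem_rcons inE; have [UT | UT] := eqVneq U T; last first.
  by rewrite update_neq // IHs.
subst U; apply: update_partial_block; first by rewrite IHs // (negPf Ts).
(* [V] may or may not have been visited already; as [tnth C i] is among its sets, both indices give
   the same partial block. *)
by move=> V VC XV; rewrite IHs //; case: ifP => // _; rewrite partial_blockS_mem.
Qed.

End Round.

Theorem theorem4p18 (N k : nat) (C : k.-tuple (itemset N)) (uniqC : uniq C)
    (visit : 'I_k -> seq {set transaction N})
    (visitP : forall i, perm_eq (visit i) (enum (blocks (collection C))))
    (T : {set transaction N}) (TC : T \in blocks (collection C)) :
  QieBlockSizes C visit T = #|T|%:Z.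
Proof.
have inv j : (j <= k)%N -> forall U, U \in blocks (collection C) ->
    foldl (fun e i => foldl (update C i) e (visit i)) (init_sizes C)
      (take j (enum 'I_k)) U =
    #|partial_block C j (sets U (collection C))|%:Z.
  elim: j => [_ U _ | j IHj ltjk U UC].
    (* The empty prefix forbids nothing, so only covering the union remains. *)
    rewrite take0 /= /init_sizes -card_covers; congr (Posz #|pred_of_set _|).
    apply/setP => t; rewrite !inE andbC; case: forall_inP => // -[] X.
    by rewrite inE take0.
  rewrite (take_nth (Ordinal ltjk)) ?size_enum_ord // foldl_rcons.
  rewrite (nth_ord_enum _ (Ordinal ltjk)).
  (* Each round visits every block exactly once, so the index becomes [j.+1] everywhere. *)
  have mem_visit := perm_mem (visitP (Ordinal ltjk)).
  rewrite (round_partial_block uniqC) // ?mem_visit ?mem_enum ?UC //.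
  - by rewrite (perm_uniq (visitP _)) enum_uniq.
  - by move=> V; rewrite mem_visit mem_enum.
  - by move=> V VC; rewrite IHj // ltnW.
have := inv k (leqnn k) T TC.
by rewrite take_oversize ?size_enum_ord // partial_block_full.
Qed.
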